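(* Let $\mathfrak F=(X,\parallel,Y,S_\vee)$ be a frame satisfying axioms (F0)–(F4). Then for every family $(A_j)_{j\in J}$ of stable sets, $\overline\eta_S\big(\bigvee_{j\in J}A_j\big)=\bigvee_{j\in J}\overline\eta_S(A_j)$, where the left join is taken in $\mathcal G(X)$ and the right join in $\mathcal G(Y)$.
   Context: A polarity is $(X,\parallel,Y)$ with $X,Y$ nonempty sets and ${\parallel}\subseteq X\times Y$; $I=(X\times Y)\setminus{\parallel}$. For $U\subseteq X$, $U'=\{y\in Y:\forall x\in U\;x\parallel y\}$; for $V\subseteq Y$, $V'=\{x\in X:\forall y\in V\;x\parallel y\}$. $A\subseteq X$ is stable if $A=A''$; $B\subseteq Y$ is co-stable if $B=B''$; $\mathcal G(X),\mathcal G(Y)$ are the complete lattices of stable/co-stable sets (meets = intersections, joins $\bigvee_jA_j=(\bigcup_jA_j)''$). Preorders: $x\preceq z$ iff $\{x\}'\subseteq\{z\}'$ on $X$; $y\preceq v$ iff $\{y\}'\subseteq\{v\}'$ on $Y$; separated means both are partial orders ($\leq$). $\Gamma u=\{w:u\preceq w\}$. Closed elements: sets $\Gamma x$ in $\mathcal G(X)$, $\Gamma y$ in $\mathcal G(Y)$. A frame is $(X,\parallel,Y,S_\vee)$ with $S_\vee\subseteq Y\times X$; $S_\vee x=\{y:yS_\vee x\}$, $yS_\vee=\{x:yS_\vee x\}$; $zS'_\vee x$ iff $\forall y(yS_\vee x\Rightarrow z\parallel y)$. Axioms: (F0) $\forall x\exists y\;xIy$, $\forall y\exists x\;xIy$;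 (F1) separated; (F2) each $S_\vee x$ is a closed element of $\mathcal G(Y)$; (F3) each $yS_\vee$ is a down-set; (F4) for each $x$, $\{z:zS'_\vee x\}\in\mathcal G(X)$ and for each $z$, $\{x:zS'_\vee x\}\in\mathcal G(X)$. For $A\in\mathcal G(X)$, $\overline\eta_S(A)=(\bigcup_{x\in A}S_\vee x)''$. *)

(* Defs.v *)
(* subsets are predicates [T -> Prop]; set equality is Leibniz
   equality of predicates (extensionality axioms are whitelisted). *)
Set Implicit Arguments.

Section Polarity.
Variables (X Y : Type) (par : X -> Y -> Prop).

Definition primeX (U : X -> Prop) : Y -> Prop :=
  fun y => forall x, U x -> par x y.
Definition primeY (V : Y -> Prop) : X -> Prop :=
  fun x => forall y, V y -> par x y.

Definition stableX (A : X -> Prop) : Prop := primeY (primeX A) = A.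
Definition costableY (B : Y -> Prop) : Prop := primeX (primeY B) = B.

Definition joinX (J : Type) (A : J -> X -> Prop) : X -> Prop :=
  primeY (primeX (fun x => exists j, A j x)).
Definition joinY (J : Type) (B : J -> Y -> Prop) : Y -> Prop :=
  primeX (primeY (fun y => exists j, B j y)).

Definition leX (x z : X) : Prop := forall y, par x y -> par z y.
Definition leY (y v : Y) : Prop := forall x, par x y -> par x v.

Definition separated : Prop :=
  (forall x z, leX x z -> leX z x -> x = z) /\
  (forall y v, leY y v -> leY v y -> y = v).

Definition GammaX (x : X) : X -> Prop := fun w => leX x w.
Definition GammaY (y : Y) : Y -> Prop := fun w => leY y w.

Definition closedY (B : Y -> Prop) : Prop := exists y, B = GammaY y.

Variable S : Y -> X -> Prop.

Definition Sx (x : X) : Y -> Prop := fun y => S y x.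
Definition yS (y : Y) : X -> Prop := fun x => S y x.
Definition Sprime (z x : X) : Prop := forall y, S y x -> par z y.

Definition F0 : Prop :=
  (forall x, exists y, ~ par x y) /\ (forall y, exists x, ~ par x y).
Definition F1 : Prop := separated.
Definition F2 : Prop := forall x, closedY (Sx x).
Definition F3 : Prop := forall y x z, yS y x -> leX z x -> yS y z.
Definition F4 : Prop :=
  (forall x, stableX (fun z => Sprime z x)) /\
  (forall z, stableX (fun x => Sprime z x)).

Definition etaS (A : X -> Prop) : Y -> Prop :=
  primeX (primeY (fun y => exists x, A x /\ Sx x y)).

End Polarity.

(* Main.v *)
(** The maps [U ↦ U'] and [V ↦ V'] form a Galois connection, so [(⋃_j B_j'')' = (⋃_j B_j)'].
    On the other side, [z ∈ (⋃_{x ∈ U} S_∨ x)'] says exactly that [U] is contained in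
    [{x | z S'_∨ x}]; by (F4) this set is stable, so [U] may be replaced by its closure
    [U'']. Applying both facts to [U = ⋃_j A_j] turns both sides into
    [(⋃_{x ∈ ⋃_j A_j} S_∨ x)'']. *)
Require Import Defs.
From Stdlib Require Import FunctionalExtensionality PropExtensionality.

Set Implicit Arguments.

Lemma set_ext (T : Type) (P Q : T -> Prop) : (forall t, P t <-> Q t) -> P = Q.
Proof.
  intro HPQ. apply functional_extensionality; intro t.
  apply propositional_extensionality, HPQ.
Qed.

Section Polarity.
Variables (X Y : Type) (par : X -> Y -> Prop).

Lemma subset_closureX (U : X -> Prop) x : U x -> primeY par (primeX par U) x.
Proof. intros Ux y Hy. exact (Hy x Ux). Qed.

Lemma subset_closureY (V : Y -> Prop) y : V y -> primeX par (primeY par V) y.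
Proof. intros Vy x Hx. exact (Hx y Vy). Qed.

Lemma closure_sub_stableX (U B : X -> Prop) :
  stableX par B -> (forall x, U x -> B x) ->
  forall x, primeY par (primeX par U) x -> B x.
Proof.
  intros HB HUB x Hx. rewrite <- HB.
  intros y Hy. apply Hx. intros x' Ux'. exact (Hy x' (HUB x' Ux')).
Qed.

Lemma primeY_union_closureY (J : Type) (B : J -> Y -> Prop) :
  primeY par (fun y => exists j, primeX par (primeY par (B j)) y)
  = primeY par (fun y => exists j, B j y).
Proof.
  apply set_ext; intro x; split.
  - intros Hx y [j Hy]. apply Hx. exists j. exact (subset_closureY _ Hy).
  - intros Hx y [j Hy]. apply Hy. intros y' By'. apply Hx. exists j. exact By'.
Qed.

Variable S : Y -> X -> Prop.

Definition Simage (U : X -> Prop) : Y -> Prop := fun y => exists x, U x /\ Sx S x y.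

Lemma primeY_SimageE (U : X -> Prop) z :
  primeY par (Simage U) z <-> forall x, U x -> Sprime par S z x.
Proof.
  split.
  - intros Hz x Ux y Sxy. apply Hz. exists x. split; assumption.
  - intros Hz y [x [Ux Sxy]]. exact (Hz x Ux y Sxy).
Qed.

Hypothesis Sprime_stable : forall z, stableX par (fun x => Sprime par S z x).

Lemma primeY_Simage_closure (U : X -> Prop) :
  primeY par (Simage (primeY par (primeX par U))) = primeY par (Simage U).
Proof.
  apply set_ext; intro z. rewrite !primeY_SimageE. split.
  - intros Hz x Ux. exact (Hz x (subset_closureX _ Ux)).
  - intros Hz. exact (closure_sub_stableX (Sprime_stable z) Hz).
Qed.

Lemma etaSE (A : X -> Prop) :
  etaS par S A = primeX par (primeY par (Simage A)).
Proof. reflexivity. Qed.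

Lemma etaS_closure (U : X -> Prop) :
  etaS par S (primeY par (primeX par U)) = primeX par (primeY par (Simage U)).
Proof. now rewrite etaSE, primeY_Simage_closure. Qed.

Lemma Simage_union (J : Type) (A : J -> X -> Prop) :
  Simage (fun x => exists j, A j x) = fun y => exists j, Simage (A j) y.
Proof.
  apply set_ext; intro y; split.
  - intros [x [[j Ax] Sxy]]. exists j, x. split; assumption.
  - intros [j [x [Ax Sxy]]]. exists x. split; [exists j |]; assumption.
Qed.

End Polarity.

Theorem proposition3p11 (X Y : Type) (par : X -> Y -> Prop) (S : Y -> X -> Prop)
  (hX : inhabited X) (hY : inhabited Y)
  (h0 : F0 par) (h1 : F1 par) (h2 : F2 par S) (h3 : F3 par S) (h4 : F4 par S)
  (J : Type) (A : J -> X -> Prop) (hA : forall j, stableX par (A j)) :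
  etaS par S (joinX par A) = joinY par (fun j => etaS par S (A j)).
Proof.
  destruct h4 as [_ Sprime_stable].
  unfold joinX, joinY.
  rewrite (etaS_closure Sprime_stable), Simage_union.
  f_equal. symmetry.
  exact (primeY_union_closureY par (fun j => Simage S (A j))).
Qed.
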